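(* Let $d\ge 2$ be an integer and let $m\ge 0$ be an integer. Let $\frac{p_{m,g_d}(x)}{q_{m,g_d}(x)}$ be the $m$-th convergent to $g_d(x)$. 1. If $m$ is odd, then there exists an integer $t\ge 0$ such that the $t$-th convergent $\frac{p_{t,u_d}(x)}{q_{t,u_d}(x)}$ to $u_d(x)$ satisfies $$\frac{p_{m,g_d}(x)}{q_{m,g_d}(x)}=\frac{p_{t,u_d}(x^d)}{(1+x+\cdots+x^{d-1})\,q_{t,u_d}(x^d)}\quad\text{with } (x-1)\nmid p_{t,u_d}(x).$$ 2. If $m$ is even, then there exists an integer $t\ge 0$ such that the $t$-th convergent $\frac{p_{t,h_d}(x)}{q_{t,h_d}(x)}$ to $h_d(x)$ satisfies $$\frac{p_{m,g_d}(x)}{q_{m,g_d}(x)}=\frac{(x-1)\,p_{t,h_d}(x^d)}{q_{t,h_d}(x^d)}\quad\text{with } (x-1)\nmid q_{t,h_d}(x).$$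
   Context: For an integer $d\ge 2$ define the Laurent series $f_d(x)=\prod_{t=0}^{\infty}(1-x^{-d^t})\in\mathbb{Q}((x^{-1}))$, and put $g_d(x)=x^{-d+1}f_d(x)$, $h_d(x)=x^{-1}f_d(x)$, $u_d(x)=(1-x^{-1})f_d(x)$. Every Laurent series $u(x)\in\mathbb{Q}((x^{-1}))$ has a continued fraction expansion $u(x)=[a_0(x);a_1(x),a_2(x),\ldots]$ with $a_i(x)\in\mathbb{Q}[x]$ and $a_i$ non-constant for $i\ge1$. For $n\ge 0$ the $n$-th convergent to $u$ is the rational function $p_{n,u}(x)/q_{n,u}(x)=[a_0(x);a_1(x),\ldots,a_n(x)]$, with $p_{n,u},q_{n,u}\in\mathbb{Q}[x]$ coprime (defined up to a common non-zero constant). *)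

(* Defs.v *)
From HB Require Import structures.
From mathcomp Require Import all_boot all_order all_algebra.
From mathcomp Require Import boolp classical_sets fsbigop functions cardinality.
From mathcomp Require Import zify.

Set Implicit Arguments.
Unset Strict Implicit.
Unset Printing Implicit Defensive.

Import Order.TTheory GRing.Theory Num.Theory.
Local Open Scope ring_scope.

(* [laurent F] is F((x^-1)): [u k] is the coefficient of x^k in u, and only
   finitely many positive powers of x occur. *)
Record laurent (F : fieldType) := Laurent {
  lcoef :> int -> F;
  lcoef_bound : exists N : int, forall k : int, N < k -> lcoef k = 0 }.

Section LaurentField.
Variable F : fieldType.
Implicit Types u v w : laurent F.

Lemma laurentP u v : u =1 v -> u = v.
Proof.
case: u v => [u hu] [v hv] /= /funext uv.
by subst v; congr Laurent; apply: Prop_irrelevance.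
Qed.

HB.instance Definition _ := gen_eqMixin (laurent F).
HB.instance Definition _ := gen_choiceMixin (laurent F).

Lemma laurent0_bound : exists N : int, forall k : int, N < k -> 0 = 0 :> F.
Proof. by exists 0. Qed.
Definition laurent0 := Laurent laurent0_bound.

Lemma laurentN_bound u : exists N : int, forall k : int, N < k -> - u k = 0.
Proof. by have [N uN] := lcoef_bound u; exists N => k /uN ->; rewrite oppr0. Qed.
Definition laurentN u := Laurent (laurentN_bound u).

Lemma laurentD_bound u v : exists N : int, forall k : int, N < k -> u k + v k = 0.
Proof.
have [M uM] := lcoef_bound u; have [N vN] := lcoef_bound v.
exists (Num.max M N) => k; rewrite gt_max => /andP[Mk Nk].
by rewrite uM // vN // addr0.
Qed.
Definition laurentD u v := Laurent (laurentD_bound u v).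

Lemma laurent_addrA : associative laurentD.
Proof. by move=> u v w; apply: laurentP => k /=; rewrite addrA. Qed.
Lemma laurent_addrC : commutative laurentD.
Proof. by move=> u v; apply: laurentP => k /=; rewrite addrC. Qed.
Lemma laurent_add0r : left_id laurent0 laurentD.
Proof. by move=> u; apply: laurentP => k /=; rewrite add0r. Qed.
Lemma laurent_addNr : left_inverse laurent0 laurentN laurentD.
Proof. by move=> u; apply: laurentP => k /=; rewrite addNr. Qed.

HB.instance Definition _ := GRing.isZmodule.Build (laurent F)
  laurent_addrA laurent_addrC laurent_add0r laurent_addNr.

(* The sum has finite support. *)
Definition lconv u v (k : int) : F := \sum_(i \in [set: int]) u i * v (k - i).

Lemma lconv_gt u v (M N k : int) :
  (forall k : int, M < k -> u k = 0) -> (forall k : int, N < k -> v k = 0) ->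
  M + N < k -> lconv u v k = 0.
Proof.
move=> uM vN MNk; rewrite /lconv fsbig1// => i _.
have [Mi|iM] := ltP M i; first by rewrite uM// mul0r.
by rewrite vN ?mulr0//; lia.
Qed.

Lemma lconvE u v (M N : int) (j : nat) :
  (forall k : int, M < k -> u k = 0) -> (forall k : int, N < k -> v k = 0) ->
  lconv u v (M + N - j%:Z) =
    \sum_(i < j.+1) u (M - i%:Z) * v (N - (j - i)%N%:Z).
Proof.
move=> uM vN; rewrite /lconv.
rewrite (@fsbigE _ _ _ _ setT [seq M - i%:Z | i <- iota 0 j.+1]) //; last first.
- move=> i _ ir.
  have [Mi|iM] := ltP M i; first by rewrite uM// mul0r.
  rewrite vN ?mulr0//; apply: contraNlt ir => h.
  apply/mapP; exists `|M - i|%N; last by lia.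
  by rewrite mem_iota; lia.
- by rewrite map_inj_uniq ?iota_uniq// => a b; lia.
under eq_bigl => i do rewrite in_setT.
rewrite big_map -[iota 0 j.+1]/(index_iota 0 j.+1) big_mkord.
apply: eq_bigr => i _; congr (_ * v _); have := ltn_ord i; lia.
Qed.

Lemma laurentM_bound u v : exists N : int, forall k : int, N < k -> lconv u v k = 0.
Proof.
have [M uM] := lcoef_bound u; have [N vN] := lcoef_bound v.
by exists (M + N) => k; apply: lconv_gt.
Qed.
Definition laurentM u v := Laurent (laurentM_bound u v).

Definition ltrunc u (M : int) (n : nat) : {poly F} :=
  \poly_(i < n.+1) u (M - i%:Z).

Lemma coef_ltrunc u M n i : (i <= n)%N -> (ltrunc u M n)`_i = u (M - i%:Z).
Proof. by move=> i_n; rewrite coef_poly ltnS i_n. Qed.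

Lemma laurentME u v (M N : int) (j n : nat) : (j <= n)%N ->
  (forall k : int, M < k -> u k = 0) -> (forall k : int, N < k -> v k = 0) ->
  laurentM u v (M + N - j%:Z) = (ltrunc u M n * ltrunc v N n)`_j.
Proof.
move=> jn uM vN; rewrite /= lconvE// coefM; apply: eq_bigr => i _.
have := ltn_ord i; rewrite ltnS => ij.
by rewrite !coef_ltrunc//; lia.
Qed.

Lemma laurent_eq_below u v (M : int) :
  (forall k : int, M < k -> u k = 0) -> (forall k : int, M < k -> v k = 0) ->
  (forall j : nat, u (M - j%:Z) = v (M - j%:Z)) -> u = v.
Proof.
move=> uM vM uv; apply: laurentP => k.
have [Mk|kM] := ltP M k; first by rewrite uM // vM.
by have -> : k = M - `|M - k|%N%:Z by lia.
Qed.

Lemma laurent_mulrC : commutative laurentM.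
Proof.
move=> u v; have [M uM] := lcoef_bound u; have [N vN] := lcoef_bound v.
apply: (@laurent_eq_below _ _ (M + N)); first by move=> k; apply: lconv_gt.
  by move=> k; rewrite addrC; apply: lconv_gt.
move=> j; rewrite (laurentME (leqnn j) uM vN) mulrC [M + N]addrC.
by rewrite (laurentME (leqnn j) vN uM).
Qed.

Lemma laurent_mulrA : associative laurentM.
Proof.
move=> u v w; have [M uM] := lcoef_bound u; have [N vN] := lcoef_bound v.
have [P wP] := lcoef_bound w.
have uvb k : M + N < k -> laurentM u v k = 0 by apply: lconv_gt.
have vwb k : N + P < k -> laurentM v w k = 0 by apply: lconv_gt.
apply: (@laurent_eq_below _ _ (M + (N + P))).
- by move=> k; apply: lconv_gt.
- by move=> k; rewrite addrA; apply: lconv_gt.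
move=> j; rewrite (laurentME (leqnn j) uM vwb) addrA.
rewrite (laurentME (leqnn j) uvb wP).
transitivity ((ltrunc u M j * (ltrunc v N j * ltrunc w P j))`_j).
  rewrite !coefM; apply: eq_bigr => i _; congr (_ * _).
  by rewrite coef_ltrunc ?leq_subr// (@laurentME _ _ _ _ _ j)// leq_subr.
rewrite mulrA !coefM; apply: eq_bigr => i _; congr (_ * _).
have := ltn_ord i; rewrite ltnS => ij.
by rewrite coef_ltrunc// (@laurentME _ _ _ _ _ j).
Qed.

Lemma laurent_mulrDl : left_distributive laurentM laurentD.
Proof.
move=> u v w; have [M0 uM0] := lcoef_bound u; have [N0 vN0] := lcoef_bound v.
have [P wP] := lcoef_bound w.
pose M := Num.max M0 N0.
have uM k : M < k -> u k = 0 by rewrite gt_max => /andP[? ?]; apply: uM0.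
have vM k : M < k -> v k = 0 by rewrite gt_max => /andP[? ?]; apply: vN0.
have uvM k : M < k -> laurentD u v k = 0.
  by move=> Mk /=; rewrite uM// vM// addr0.
apply: (@laurent_eq_below _ _ (M + P)).
- by move=> k; apply: lconv_gt.
- move=> k Mk.
  by rewrite /= (lconv_gt uM wP Mk) (lconv_gt vM wP Mk) addr0.
move=> j; rewrite /= !lconvE// -big_split; apply: eq_bigr => i _ /=.
by rewrite mulrDl.
Qed.

Lemma lmono_bound (n : int) :
  exists N : int, forall k : int, N < k -> (k == n)%:R = 0 :> F.
Proof. by exists n => k nk; rewrite gt_eqF. Qed.
(* The monomial x^n, for n an arbitrary integer. *)
Definition lmono n : laurent F := Laurent (lmono_bound n).

Lemma laurentM_mono n u k : laurentM (lmono n) u k = u (k - n).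
Proof.
rewrite /= /lconv (@fsbigE _ _ _ _ setT [:: n])//=.
  by rewrite big_cons big_nil in_setT addr0 /= eqxx mul1r.
by move=> i _; rewrite inE => /negbTE ->; rewrite mul0r.
Qed.

Lemma laurent_mul1r : left_id (lmono 0) laurentM.
Proof. by move=> u; apply: laurentP => k; rewrite laurentM_mono subr0. Qed.

Lemma laurent1_neq0 : lmono 0 != 0.
Proof.
apply/eqP => /(congr1 (fun u : laurent F => u 0)) /= /eqP.
by rewrite oner_eq0.
Qed.

HB.instance Definition _ := GRing.Zmodule_isComNzRing.Build (laurent F)
  laurent_mulrA laurent_mulrC laurent_mul1r laurent_mulrDl laurent1_neq0.

Lemma lcoef0 k : (0 : laurent F) k = 0. Proof. by []. Qed.
Lemma lcoefD u v k : (u + v) k = u k + v k. Proof. by []. Qed.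
Lemma lcoefN u k : (- u) k = - u k. Proof. by []. Qed.
Lemma lcoefM u v k : (u * v) k = \sum_(i \in [set: int]) u i * v (k - i).
Proof. by []. Qed.
Lemma lcoef1 k : (1 : laurent F) k = (k == 0)%:R. Proof. by []. Qed.
Lemma lcoef_monoM n u k : (lmono n * u) k = u (k - n).
Proof. exact: laurentM_mono. Qed.
Lemma lmonoD m n : lmono (m + n) = lmono m * lmono n.
Proof.
by apply: laurentP => k; rewrite lcoef_monoM /= subr_eq [n + m]addrC.
Qed.

Lemma laurent_lead u : u != 0 ->
  exists2 M, u M != 0 & forall k : int, M < k -> u k = 0.
Proof.
move=> u0; have [N uN] := lcoef_bound u.
have ex : exists j : nat, u (N - j%:Z) != 0.
  apply: contrapT => nex; move/eqP: u0; apply.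
  apply: (laurent_eq_below uN) => // j.
  by apply/eqP; apply: contrapT => /negP h; apply: nex; exists j.
have [j uj jmin] := ex_minnP ex; exists (N - j%:Z) => // k jk.
have [Nk|kN] := ltP N k; first exact: uN.
apply/eqP; apply: contraT => uk.
have := jmin `|N - k|%N; have -> : N - `|N - k|%N%:Z = k by lia.
by move=> /(_ uk); lia.
Qed.

Fixpoint inv_coefs (a : nat -> F) (n : nat) : seq F :=
  if n is n'.+1 then
    let s := inv_coefs a n' in
    rcons s (((n' == 0)%:R - \sum_(i < n') a i.+1 * s`_(n' - i.+1)) / a 0)
  else [::].

Lemma size_inv_coefs a n : size (inv_coefs a n) = n.
Proof. by elim: n => //= n IHn; rewrite size_rcons IHn. Qed.

Lemma nth_inv_coefs a n i : (i < n)%N ->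
  (inv_coefs a n)`_i = (inv_coefs a i.+1)`_i.
Proof.
elim: n => // n IHn; rewrite ltnS leq_eqVlt => /predU1P[->//|i_n].
by rewrite [in LHS]/= nth_rcons size_inv_coefs i_n IHn.
Qed.

Lemma inv_coefsP (a : nat -> F) : a 0 != 0 ->
  exists b : nat -> F, forall j : nat,
    \sum_(i < j.+1) a i * b (j - i)%N = (j == 0)%:R.
Proof.
move=> a0; exists (fun i => (inv_coefs a i.+1)`_i) => j.
rewrite big_ord_recl subn0 /= nth_rcons size_inv_coefs ltnn eqxx.
rewrite mulrCA divff// mulr1 [X in _ - X + _](_ : _ =
  \sum_(i < j) a (lift ord0 i) * (inv_coefs a (j - lift ord0 i).+1)`_(j - lift ord0 i)).
  by rewrite subrK.
apply: eq_bigr => i _; rewrite lift0; congr (_ * _).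
by rewrite nth_inv_coefs// ; have := ltn_ord i; lia.
Qed.

Lemma laurent_has_inv u : u != 0 -> exists v, v * u = 1.
Proof.
move=> /laurent_lead[M uM Mu].
have [|b bP] := @inv_coefsP (fun i : nat => u (M - i%:Z)).
  by rewrite subr0.
have vb : exists N : int, forall k : int, N < k ->
    (if k <= - M then b `|- M - k|%N else 0) = 0.
  by exists (- M) => k Mk; rewrite leNgt Mk.
pose v : laurent F := Laurent vb.
have vM k : - M < k -> v k = 0 by move=> Mk; rewrite /= leNgt Mk.
exists v; rewrite mulrC; apply: (@laurent_eq_below _ _ (M - M)).
- by move=> k; apply: lconv_gt.
- by rewrite subrr => k k0; rewrite lcoef1 gt_eqF.
move=> j; rewrite /= (@lconvE u v M (- M))// [RHS](_ : _ = (j == 0)%:R).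
  rewrite -bP; apply: eq_bigr => i _ /=; congr (_ * _).
  by rewrite ifT; [congr (b _)|]; have := ltn_ord i; lia.
by rewrite addrN sub0r oppr_eq0 /=.
Qed.

Definition laurentV u : laurent F := xget 0 [set v | v * u = 1].

Lemma laurent_mulVf u : u != 0 -> laurentV u * u = 1.
Proof.
by move=> /laurent_has_inv ex; apply: (xgetPex 0 (P := [set v | v * u = 1])).
Qed.

Lemma laurent_invr0 : laurentV 0 = 0.
Proof.
rewrite /laurentV; case: xgetP => // v _ /= /eqP.
by rewrite mulr0 eq_sym oner_eq0.
Qed.

HB.instance Definition _ := GRing.ComNzRing_isField.Build (laurent F)
  laurent_mulVf laurent_invr0.

Lemma lpoly_bound (p : {poly F}) : exists N : int, forall k : int, N < k ->
  (if k is Posz n then p`_n else 0) = 0.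
Proof.
exists (size p)%:Z => -[] // n pn.
by apply: nth_default; move: pn; rewrite ltz_nat => /ltnW.
Qed.
Definition lpoly (p : {poly F}) : laurent F := Laurent (lpoly_bound p).

Definition lfloor u : {poly F} :=
  \poly_(i < `|projT1 (cid (lcoef_bound u))|.+1) u i%:Z.

(* So [lfloor u] is the polynomial part of [u]. *)
Lemma coef_lfloor u (n : nat) : (lfloor u)`_n = u n%:Z.
Proof.
rewrite coef_poly; case: (cid _) => N uN /=; case: ltnP => // Nn.
by rewrite uN//; lia.
Qed.

(* Convergence in the x^-1-adic topology. *)
Definition lcvg (s : nat -> laurent F) (l : laurent F) :=
  forall K : int, exists n0 : nat, forall (n : nat) (k : int),
    (n0 <= n)%N -> K <= k -> s n k = l k.

Lemma lcvg_unique s l1 l2 : lcvg s l1 -> lcvg s l2 -> l1 = l2.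
Proof.
move=> c1 c2; apply: laurentP => k.
have [n1 h1] := c1 k; have [n2 h2] := c2 k.
by rewrite -(h1 (maxn n1 n2)) ?leq_maxl// (h2 (maxn n1 n2)) ?leq_maxr.
Qed.

(* The infinite product of the [a t], when its partial products converge. *)
Definition linfprod (a : nat -> laurent F) : laurent F :=
  xget 0 [set l | lcvg (fun n => \prod_(t < n) a t) l].

End LaurentField.

(* The value [a0; a1, ..., an] of a finite continued fraction. *)
Fixpoint cf_value (K : fieldType) (a0 : K) (s : seq K) : K :=
  if s is a1 :: s' then a0 + (cf_value a1 s')^-1 else a0.

Section ContinuedFraction.
Variable F : fieldType.
Implicit Types u : laurent F.

Fixpoint complete_quotient u (n : nat) : laurent F :=
  if n is n'.+1 then
    let v := complete_quotient u n' in (v - lpoly (lfloor v))^-1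
  else u.

Definition partial_quotient u n : {poly F} := lfloor (complete_quotient u n).

(* The expansion of [u] stops at index [i] exactly when the [i]-th complete
   quotient is a polynomial; beyond that, [complete_quotient] is junk. *)
Definition cf_reaches u n := forall i, (i < n)%N ->
  complete_quotient u i != lpoly (partial_quotient u i).

Definition is_convergent u n (p q : {poly F}) : Prop :=
  [/\ cf_reaches u n, q != 0, coprimep p q &
      tofrac p / tofrac q =
        cf_value (tofrac (partial_quotient u 0))
          [seq tofrac (partial_quotient u i) | i <- iota 1 n]
        :> {fraction {poly F}}].

End ContinuedFraction.

Definition f_ (d : nat) : laurent rat :=
  linfprod (fun t => 1 - lmono rat (- (d ^ t)%N%:Z)).
Definition g_ d : laurent rat := lmono rat (- d%:Z + 1) * f_ d.
Definition h_ d : laurent rat := lmono rat (- 1) * f_ d.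
Definition u_ d : laurent rat := (1 - lmono rat (- 1)) * f_ d.

Lemma f_cvg d : (2 <= d)%N ->
  lcvg (fun n => \prod_(t < n) (1 - lmono rat (- (d ^ t)%N%:Z))) (f_ d).
Proof.
move=> d2; set s := fun n => _.
suff ex : exists l, lcvg s l.
  exact: (xgetPex 0 (P := [set l | lcvg s l])).
have sS n k : s n.+1 k = s n k - s n (k + (d ^ n)%N%:Z).
  have -> : s n.+1 = s n * (1 - lmono rat (- (d ^ n)%N%:Z)).
    by rewrite /s big_ord_recr.
  rewrite mulrBr mulr1 lcoefD lcoefN.
  by rewrite [_ * lmono _ _]mulrC lcoef_monoM opprK.
have s_gt0 n (k : int) : 0 < k -> s n k = 0.
  elim: n k => [|n IHn] k k0; first by rewrite /s big_ord0 lcoef1 gt_eqF.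
  by rewrite sS !IHn ?subr0// ltr_wpDr.
have s_cst n k : (`|k| <= n)%N -> s n k = s `|k|%N k.
  elim: n => [|n IHn]; first by rewrite leqn0 => /eqP ->.
  rewrite leq_eqVlt => /predU1P[<-//|kn]; rewrite sS IHn//.
  by rewrite [s n (k + _)]s_gt0 ?subr0//; have := ltn_expl n d2; lia.
have lb : exists N : int, forall k : int, N < k -> s `|k|%N k = 0.
  by exists 0 => k; apply: s_gt0.
exists (Laurent lb) => K; exists `|K|%N => n k Kn Kk /=.
have [k0|k0] := ltP 0 k; first by rewrite !s_gt0.
by apply: s_cst; lia.
Qed.

(* Main.v *)
Require Import Defs.
From HB Require Import structures.
From mathcomp Require Import all_boot all_order all_algebra.
From mathcomp Require Import boolp fsbigop zify ring.

Set Implicit Arguments.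
Unset Strict Implicit.
Unset Printing Implicit Defensive.

Import Order.TTheory GRing.Theory Num.Theory.
Local Open Scope ring_scope.

(** Write [f], [g], [h], [u] for the four series, [S] for
    [1 + x + ... + x^(d-1)], and [v(x^d)] for the series obtained from [v] by
    substitution. The product defining [f] gives
    [f(x) = (1 - 1/x) f(x^d)], hence
      [u = (x - 1) h],  [g = (x - 1) h(x^d)],  [S g = u(x^d)].
    So an approximation [P/Q] of [h] yields the approximation
    [(x - 1) P(x^d) / Q(x^d)] of [g], and an approximation [P/Q] of [u] yields
    [P(x^d) / (S Q(x^d))]. What has to be shown is that all convergents of [g]
    arise in this way, and that the two kinds alternate.

    Continued fractions enter through two classical facts only. Convergents are
    the reduced fractions [p/q] with [deg (q v - p) < - deg q]
    ([convergent_best], [best_convergent]: Legendre's criterion, which is an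
    equivalence for Laurent series); and if [p'/q'] follows [p/q], then
    [deg (q v - p) = - deg q'] ([convergent_error_deg]). The degree of the
    denominator determines a best approximation ([best_approx_uniq]). Hence,
    to identify the convergent of [g] that follows [p/q], it is enough to
    exhibit an approximation whose denominator has degree [- deg (q g - p)].

    Suppose that [p/q] comes from the convergent [P/Q] of [h], where
    [Q(1) <> 0], and let [b = - deg (Q h - P)]. Then [q g - p] has degree
    [1 - d b], so a denominator of degree [d b - 1] is wanted. Take
    [P'], [Q'] with [P' Q - P Q' = 1], [deg Q' = b] and
    [deg (Q' h - P') < - b] ([next_best_approx]), and subtract from [(P', Q')]
    the multiple of [(P, Q)] that makes the denominator vanish at [1]. Its
    denominator is [(x - 1) Q2] with [deg Q2 = b - 1], and because
    [u = (x - 1) h], the new numerator over [Q2] is a best approximation of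
    [u]; the determinant, evaluated at [1], shows that its numerator does not
    vanish there. Through [u] it gives a denominator of degree
    [(d - 1) + d (b - 1) = d b - 1] for [g], as wanted ([from_h_next]). The
    passage from [u] back to [h] is the same, now with a numerator made to
    vanish at [1] ([from_u_next]). The induction starts at the convergent
    [0/1] of [g], which comes from [0/1] for [h]. *)

(** * The degree of a Laurent series *)

Section LaurentDegree.
Variable F : fieldType.
Implicit Types (u v w e : laurent F) (m n k : int).

(** The degree is a relation rather than a function, so that the zero series,
    which satisfies [deg_lt] for every bound, needs no convention. *)
Definition deg_lt v n : Prop := forall k, n <= k -> v k = 0.

Definition has_deg v n : Prop := v n != 0 /\ deg_lt v (n + 1).

Lemma deg_lt_le v m n : m <= n -> deg_lt v m -> deg_lt v n.
Proof. by move=> mn vm k nk; apply: vm; apply: le_trans nk. Qed.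

Lemma deg_ltD u v n : deg_lt u n -> deg_lt v n -> deg_lt (u + v) n.
Proof. by move=> un vn k nk; rewrite lcoefD un// vn// addr0. Qed.

Lemma deg_ltN v n : deg_lt v n -> deg_lt (- v) n.
Proof. by move=> vn k nk; rewrite lcoefN vn// oppr0. Qed.

Lemma deg_ltB u v n : deg_lt u n -> deg_lt v n -> deg_lt (u - v) n.
Proof. by move=> un vn; apply: deg_ltD => //; apply: deg_ltN. Qed.

Lemma deg_ltM u v m n : deg_lt u m -> deg_lt v n -> deg_lt (u * v) (m + n - 1).
Proof.
move=> um vn k k_ge; apply: (@lconv_gt _ _ _ (m - 1) (n - 1)).
- by move=> i i_gt; apply: um; lia.
- by move=> i i_gt; apply: vn; lia.
- lia.
Qed.

Lemma has_deg_neq0 v n : has_deg v n -> v != 0.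
Proof. by move=> [vn _]; apply: contraNneq vn => ->; rewrite lcoef0. Qed.

Lemma has_deg_exists v : v != 0 -> exists n, has_deg v n.
Proof.
by move=> /laurent_lead[n vn vgt]; exists n; split=> // k nk; apply: vgt; lia.
Qed.

Lemma has_deg_lt v m n : has_deg v m -> deg_lt v n -> m < n.
Proof.
move=> [vm _] vn; rewrite ltNge; apply/negP => nm.
by move: vm; rewrite vn ?eqxx.
Qed.

Lemma has_deg_uniq v m n : has_deg v m -> has_deg v n -> m = n.
Proof.
move=> vm vn; have := has_deg_lt vm (proj2 vn).
by have := has_deg_lt vn (proj2 vm); lia.
Qed.

Lemma has_degM u v m n : has_deg u m -> has_deg v n -> has_deg (u * v) (m + n).
Proof.
move=> [um ult] [vn vlt]; split; last first.
  by apply: deg_lt_le (deg_ltM ult vlt); lia.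
have ugt k : m < k -> u k = 0 by move=> mk; apply: ult; lia.
have vgt k : n < k -> v k = 0 by move=> nk; apply: vlt; lia.
have := lconvE 0 ugt vgt; rewrite !subr0 big_ord1 !subr0 => uvE.
by rewrite [(u * v) _]uvE mulf_neq0.
Qed.

Lemma has_degN v n : has_deg v n -> has_deg (- v) n.
Proof. by move=> [vn vlt]; split; [rewrite lcoefN oppr_eq0|apply: deg_ltN]. Qed.

Lemma has_degD u v n : has_deg u n -> deg_lt v n -> has_deg (u + v) n.
Proof.
move=> [un ult] vn; split; first by rewrite lcoefD vn// addr0.
by apply: deg_ltD => //; apply: deg_lt_le vn; lia.
Qed.

Lemma has_deg1 : has_deg 1 0.
Proof. by split=> [|k k_ge]; rewrite lcoef1 ?oner_eq0// gt_eqF//; lia. Qed.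

Lemma has_degV v n : has_deg v n -> has_deg v^-1 (- n).
Proof.
move=> vn; have v0 := has_deg_neq0 vn.
have [m vm] := has_deg_exists (invr_neq0 v0).
have := has_degM vn vm; rewrite divff// => d1.
by have e := has_deg_uniq d1 has_deg1; have -> : - n = m by lia.
Qed.

Lemma has_deg_ltM u v m n : has_deg u m -> deg_lt v n -> deg_lt (u * v) (m + n).
Proof. by move=> [_ ult] /(deg_ltM ult); apply: deg_lt_le; lia. Qed.

Lemma has_deg_ltMK u v m n :
  has_deg u m -> deg_lt (u * v) (m + n) -> deg_lt v n.
Proof.
move=> um uvn; rewrite -[v](mulKf (has_deg_neq0 um)).
by apply: deg_lt_le (has_deg_ltM (has_degV um) uvn); lia.
Qed.

Lemma deg_lt_lmono n : deg_lt (lmono F n) (n + 1).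
Proof. by move=> k k_ge /=; rewrite gt_eqF//; lia. Qed.

Lemma has_deg_lmono n : has_deg (lmono F n) n.
Proof. by split; [rewrite /= eqxx oner_eq0|apply: deg_lt_lmono]. Qed.

End LaurentDegree.

(** * Polynomials as Laurent series *)

Section PolynomialsAsSeries.
Variable F : fieldType.
Implicit Types (u v w e : laurent F) (p q : {poly F}).

Lemma lcoef_lpoly p k : lpoly p k = if k is Posz n then p`_n else 0.
Proof. by []. Qed.

Lemma lcoef_lpolyZ (c : F) p k : lpoly (c *: p) k = c * lpoly p k.
Proof. by case: k => n; rewrite !lcoef_lpoly ?coefZ ?mulr0. Qed.

Lemma lpoly_is_zmod_morphism : zmod_morphism (@lpoly F).
Proof.
move=> p q; apply: laurentP => -[n|n]; rewrite lcoefD lcoefN !lcoef_lpoly.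
  by rewrite coefB.
by rewrite subr0.
Qed.
HB.instance Definition _ := GRing.isZmodMorphism.Build {poly F} (laurent F)
  (@lpoly F) lpoly_is_zmod_morphism.

Lemma lcoef_lpolyC_M (c : F) v k : (lpoly c%:P * v) k = c * v k.
Proof.
rewrite lcoefM (@fsbigE _ _ _ _ _ [:: 0])//=.
  by rewrite big_cons big_nil classical_sets.in_setT addr0 subr0 /= coefC.
move=> [[|n]|n] _; rewrite inE //= => _; last by rewrite mul0r.
by rewrite coefC mul0r.
Qed.

Lemma lpolyMX p : lpoly (p * 'X) = lmono F 1 * lpoly p.
Proof.
apply: laurentP => k; rewrite lcoef_monoM.
case: k => [[|n]|n].
- by rewrite lcoef_lpoly coefMX.
- have -> : n.+1%:Z - 1 = n by lia.
  by rewrite !lcoef_lpoly coefMX.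
- by have -> : Negz n - 1 = Negz n.+1 by lia.
Qed.

Lemma lpoly_is_monoid_morphism : monoid_morphism (@lpoly F).
Proof.
split=> [|p q].
  by apply: laurentP => -[n|n]; rewrite lcoef_lpoly lcoef1// coef1.
(* Horner's scheme reduces products by [p] to products by ['X] and constants. *)
elim/poly_ind: p => [|p c IHp]; first by rewrite mul0r raddf0 mul0r.
rewrite mulrDl !raddfD/= mulrDl mulrAC !lpolyMX IHp mulrA; congr (_ + _).
apply: laurentP => k; rewrite lcoef_lpolyC_M.
by case: k => [n|n]; rewrite !lcoef_lpoly ?coefCM// mulr0.
Qed.
HB.instance Definition _ := GRing.isMonoidMorphism.Build {poly F} (laurent F)
  (@lpoly F) lpoly_is_monoid_morphism.

Lemma lpolyX : lpoly 'X = lmono F 1.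
Proof. by rewrite -['X]mul1r lpolyMX rmorph1 mulr1. Qed.

(** Integer-valued, as it is compared with the possibly negative degrees of
    approximation errors. *)
Definition pdeg p : int := (size p).-1%:Z.

Lemma has_deg_lpoly p : p != 0 -> has_deg (lpoly p) (pdeg p).
Proof.
move=> p0; split; first by rewrite /= -[_`_ _]/(lead_coef p) lead_coef_eq0.
case=> [n|//]; rewrite /pdeg => n_ge; have lt_n : ((size p).-1 < n)%N by lia.
by rewrite lcoef_lpoly nth_default// (leq_trans (leqSpred _) lt_n).
Qed.

Lemma lpoly_eq0 p : (lpoly p == 0) = (p == 0).
Proof.
apply/eqP/eqP => [p0|->]; last exact: raddf0.
by apply/polyP => i; rewrite coef0 -[RHS](lcoef0 F i) -p0.
Qed.

Lemma pdegM p q :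
  p != 0 -> q != 0 -> pdeg (p * q) = pdeg p + pdeg q.
Proof.
move=> p0 q0; apply: (@has_deg_uniq _ (lpoly (p * q))).
  by apply: has_deg_lpoly; rewrite mulf_neq0.
by rewrite rmorphM /=; apply: has_degM; apply: has_deg_lpoly.
Qed.

Lemma deg_lt_lpoly p : deg_lt (lpoly p) 0 -> p = 0.
Proof.
by move=> p_lt; apply/polyP => i; rewrite coef0; apply: (p_lt i).
Qed.

Lemma deg_lt_fracpart v : deg_lt (v - lpoly (lfloor v)) 0.
Proof.
by case=> [n|//] _; rewrite lcoefD lcoefN lcoef_lpoly coef_lfloor subrr.
Qed.

Lemma lfloor_uniq v p : deg_lt (v - lpoly p) 0 -> lfloor v = p.
Proof.
move=> vp; apply/polyP => i; rewrite coef_lfloor; apply/eqP.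
by rewrite -subr_eq0 -[_ - _]/((v - lpoly p) i) vp.
Qed.

End PolynomialsAsSeries.

(** * Best approximations *)

Section BestApproximations.
Variable F : fieldType.
Implicit Types (u v w e : laurent F) (p q r : {poly F}).

(** Equivalent to [p / q] being a convergent of [v]: this is
    [deg (v - p / q) < - 2 deg q], cleared of denominators. *)
Definition best_approx v p q : Prop :=
  [/\ q != 0, coprimep p q & deg_lt (lpoly q * v - lpoly p) (- pdeg q)].

Lemma best_approxZ v p q c : c != 0 ->
  best_approx v p q -> best_approx v (c *: p) (c *: q).
Proof.
move=> c0 [q0 pq e_lt]; split.
- by rewrite scaler_eq0 negb_or c0.
- by rewrite coprimepZl// coprimepZr.
rewrite /pdeg size_scale// -!mul_polyC !rmorphM /= -mulrA -mulrBr.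
by move=> k k_ge; rewrite lcoef_lpolyC_M e_lt// mulr0.
Qed.

(** Determinants of pairs of approximations are governed by their errors: when
    both errors are small, the polynomial on the left has negative degree and
    is zero. *)
Lemma cross_det v p q p' q' :
  lpoly (p' * q - p * q') =
  lpoly q' * (lpoly q * v - lpoly p) - lpoly q * (lpoly q' * v - lpoly p').
Proof. by rewrite rmorphB !rmorphM /=; ring. Qed.

(** The determinant of the two pairs is a polynomial of negative degree, so the
    fractions agree; equality of the degrees then forces [p1 / q1] to be reduced
    as well. *)
Lemma best_approx_uniq v p q p1 q1 :
  best_approx v p q -> q1 != 0 -> pdeg q1 = pdeg q ->
  deg_lt (lpoly q1 * v - lpoly p1) (- pdeg q1) ->
  exists2 c, c != 0 & p1 = c *: p /\ q1 = c *: q.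
Proof.
move=> [q0 pq e_lt] q10 dq e1_lt.
have dq' : size q1 = size q.
  move: dq q0 q10; rewrite -!size_poly_gt0 /pdeg.
  by move: (size _) (size _); lia.
have /eqP : p1 * q - p * q1 = 0.
  apply: deg_lt_lpoly; rewrite (cross_det v); apply: deg_ltB.
    rewrite -(addrN (pdeg q1)) {2}dq.
    by apply: has_deg_ltM => //; apply: has_deg_lpoly.
  rewrite -(addrN (pdeg q1)) {1}dq.
  by apply: has_deg_ltM => //; apply: has_deg_lpoly.
rewrite subr_eq0 => /eqP pq1.
have q_dvd : q %| q1.
  by rewrite -(@Gauss_dvdpr _ q1 p) 1?coprimep_sym// -pq1 dvdp_mull.
have : q %= q1 by rewrite -dvdp_size_eqp// dq'.
case/eqpP => -[a b] /= /andP[a0 b0] ab.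
have q1E : q1 = (a / b) *: q.
  by rewrite mulrC -scalerA ab scalerA mulVf// scale1r.
exists (a / b); first by rewrite mulf_neq0 ?invr_eq0.
split=> //; apply: (mulIf q0).
by rewrite pq1 q1E -scalerAr scalerAl.
Qed.

(** The next convergent, obtained from a Bezout relation. Solutions of
    [p' q - p q' = 1] differ by polynomial multiples of [(p, q)]; such a
    multiple, chosen as the integral part of a quotient of errors, makes the
    error of [(p', q')] smaller than that of [(p, q)], and then the
    determinant forces the degree of [q']. *)
Lemma next_best_approx v p q b :
  best_approx v p q -> has_deg (lpoly q * v - lpoly p) (- b) ->
  exists p' q', [/\ p' * q - p * q' = 1, q' != 0, pdeg q' = b &
    deg_lt (lpoly q' * v - lpoly p') (- b)].
Proof.
move=> [q0 pq e_lt] e_deg; set e := _ - _ in e_lt e_deg.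
have qb := has_deg_lt e_deg e_lt.
have /Bezout_eq1_coprimepP[[s t] /= st] := pq.
set e0 := lpoly (- s) * v - lpoly t.
pose z := lfloor (- e0 / e); pose q' := - s + z * q; pose p' := t + z * p.
have det1 : p' * q - p * q' = 1 by rewrite -st /p' /q'; ring.
have e'E : lpoly q' * v - lpoly p' = - ((- e0 / e - lpoly z) * e).
  rewrite mulrBl divfK ?(has_deg_neq0 e_deg)// opprB /q' /p'.
  rewrite !rmorphD /= !rmorphM /=.
  by rewrite /e /e0; ring.
have e'_lt : deg_lt (lpoly q' * v - lpoly p') (- b).
  rewrite e'E mulrC; apply: deg_ltN; rewrite -[- b]addr0.
  by apply: has_deg_ltM => //; apply: deg_lt_fracpart.
have q'e : has_deg (lpoly q' * e) 0.
  have -> : lpoly q' * e = 1 + lpoly q * (lpoly q' * v - lpoly p').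
    by have := cross_det v p q p' q'; rewrite det1 rmorph1 => ->; rewrite subrK.
  apply: has_degD (has_deg1 _) _.
  by apply: deg_lt_le (has_deg_ltM (has_deg_lpoly q0) e'_lt); lia.
have q'0 : q' != 0.
  by apply: contraNneq (has_deg_neq0 q'e) => ->; rewrite raddf0 mul0r.
exists p', q'; split=> //.
have := has_deg_uniq q'e (has_degM (has_deg_lpoly q'0) e_deg); lia.
Qed.

End BestApproximations.

(** * Convergents are best approximations *)

Section Convergents.
Variable F : fieldType.
Implicit Types (u v w e : laurent F) (p q r : {poly F}).

Definition cf_tail v : laurent F := (v - lpoly (lfloor v))^-1.

(** Expanding [v] for [n + 1] steps amounts to expanding [cf_tail v] for [n]
    steps, so that facts on convergents can be proved by induction on [n] with
    [v] varying. *)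
Lemma complete_quotient_tail v n :
  complete_quotient v n.+1 = complete_quotient (cf_tail v) n.
Proof. by elim: n => //= n <-. Qed.

Lemma cf_reaches_tail v n :
  cf_reaches v n.+1 <-> v != lpoly (lfloor v) /\ cf_reaches (cf_tail v) n.
Proof.
split=> [vn|[v0 vn]].
  split=> [|i i_n]; first exact: (vn 0).
  by have := vn i.+1 i_n; rewrite /partial_quotient complete_quotient_tail.
case=> [//|i] i_n.
by rewrite /partial_quotient complete_quotient_tail; apply: vn.
Qed.

Definition cf_truncation v n : {fraction {poly F}} :=
  cf_value (tofrac (partial_quotient v 0))
    [seq tofrac (partial_quotient v i) | i <- iota 1 n].

Lemma cf_truncation_tail v n :
  cf_truncation v n.+1 = tofrac (lfloor v) + (cf_truncation (cf_tail v) n)^-1.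
Proof.
rewrite /cf_truncation /=; congr (_ + (cf_value _ _)^-1).
rewrite -[in LHS](addn1 1) iotaDl -map_comp; apply: eq_map => i /=.
by rewrite /partial_quotient complete_quotient_tail.
Qed.

Lemma reduced_fraction v n : exists p q,
  [/\ q != 0, coprimep p q & tofrac p / tofrac q = cf_truncation v n].
Proof.
elim: n v => [|n IHn] v.
  exists (partial_quotient v 0), 1; split; rewrite ?oner_neq0 ?coprimep1//.
  by rewrite tofrac1 divr1.
rewrite cf_truncation_tail; have [p [q [q0 pq <-]]] := IHn (cf_tail v).
have [->|p0] := eqVneq p 0.
  exists (lfloor v), 1; rewrite oner_neq0 coprimep1; split=> //.
  by rewrite tofrac1 divr1 tofrac0 mul0r invr0 addr0.
exists (lfloor v * p + q), p; split=> //.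
  by rewrite coprimep_sym coprimep_addl_mul.
by rewrite tofracD tofracM mulrDl mulfK ?tofrac_eq0// invf_div.
Qed.

Lemma convergent_of_reaches v n :
  cf_reaches v n -> exists p q, is_convergent v n p q.
Proof.
by move=> vn; have [p [q [q0 pq E]]] := reduced_fraction v n; exists p, q.
Qed.

(** The identity behind this and [convergent_tail] is
    [(a q + r) / q = a + 1 / (q / r)]. *)
Lemma convergent_cons v n q r : v != lpoly (lfloor v) -> q != 0 ->
  is_convergent (cf_tail v) n q r -> is_convergent v n.+1 (lfloor v * q + r) q.
Proof.
move=> v0 q0 [vn r0 qr E]; split=> //.
- exact/cf_reaches_tail.
- by rewrite coprimep_sym coprimep_addl_mul.
rewrite -/(cf_truncation v n.+1) cf_truncation_tail /cf_truncation -E.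
by rewrite tofracD tofracM mulrDl mulfK ?tofrac_eq0// invf_div.
Qed.

Lemma convergent_tail v n p q : p != lfloor v * q ->
  is_convergent v n.+1 p q -> is_convergent (cf_tail v) n q (p - lfloor v * q).
Proof.
move=> r0 [/cf_reaches_tail[_ vn] q0 pq E]; split=> //.
- by rewrite subr_eq0.
- by rewrite addrC -mulNr coprimep_addl_mul coprimep_sym.
move: E; rewrite -/(cf_truncation v n.+1) cf_truncation_tail.
rewrite -/(cf_truncation (cf_tail v) n) => E.
have -> : cf_truncation (cf_tail v) n =
    (tofrac p / tofrac q - tofrac (lfloor v))^-1.
  by rewrite E addrC addKr invrK.
by rewrite tofracB tofracM -invf_div mulrBl mulfK ?tofrac_eq0.
Qed.

Lemma cf_tail_deg v : v != lpoly (lfloor v) ->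
  exists2 a, 0 < a & has_deg (v - lpoly (lfloor v)) (- a).
Proof.
rewrite -subr_eq0 => /has_deg_exists[a a_deg]; exists (- a); rewrite ?opprK//.
by have := has_deg_lt a_deg (@deg_lt_fracpart _ v); lia.
Qed.

(** Passing to the tail multiplies the error by [- (v - a)], whose degree is
    the opposite of that of the tail: this carries error bounds through the
    inductions below. *)
Lemma cf_error v p q (a := lfloor v) : v != lpoly a ->
  lpoly q * v - lpoly p =
  - ((lpoly (p - a * q) * cf_tail v - lpoly q) * (v - lpoly a)).
Proof.
rewrite -subr_eq0 => w0; rewrite /cf_tail -/a mulrBl mulfVK//.
by rewrite rmorphB rmorphM /=; ring.
Qed.

(** For [r = p - a q], the denominator of the tail's approximation [q / r],
    [r] is [q (v - a)] up to an error of negative degree. *)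
Lemma cf_tail_partial_degree v a p q : v != lpoly (lfloor v) ->
  has_deg (v - lpoly (lfloor v)) (- a) -> p != lfloor v * q -> q != 0 ->
  deg_lt (lpoly q * v - lpoly p) 0 -> pdeg q = a + pdeg (p - lfloor v * q).
Proof.
move=> v0 w_deg r0 q0 e_lt; set r := p - _.
have r_deg : has_deg (lpoly r) (pdeg r).
  by apply: has_deg_lpoly; rewrite subr_eq0.
have qwE : lpoly q * (v - lpoly (lfloor v)) =
    lpoly r + (lpoly q * v - lpoly p).
  by rewrite /r rmorphB rmorphM /=; ring.
have := has_degM (has_deg_lpoly q0) w_deg; rewrite qwE => qw_deg.
suff /(has_deg_uniq qw_deg) :
    has_deg (lpoly r + (lpoly q * v - lpoly p)) (pdeg r) by lia.
by apply: has_degD => //; apply: deg_lt_le e_lt; rewrite /pdeg; lia.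
Qed.

Lemma convergent0 v p q :
  is_convergent v 0 p q -> p = lfloor v * q /\ pdeg q = 0.
Proof.
move=> [_ q0 pq]; rewrite /= -[partial_quotient v 0]/(lfloor v) => E.
have pE : p = lfloor v * q.
  apply/eqP; rewrite -tofrac_eq tofracM -E divfK//.
  by rewrite tofrac_eq0.
split=> //; move: pq; rewrite pE coprimepMl coprimepp => /andP[_ /eqP q1].
by rewrite /pdeg q1.
Qed.

Lemma convergent_nonpoly v n p q :
  is_convergent v n.+1 p q -> v != lpoly (lfloor v).
Proof. by move=> [/cf_reaches_tail[]]. Qed.

(** If [p = a q], then the expansion of the tail would have value [0]; but
    [0 / 1] is not a best approximation of a series of positive degree. *)
Lemma convergent_neq_floor v n p q :
  (forall p1 q1, is_convergent (cf_tail v) n p1 q1 ->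
     best_approx (cf_tail v) p1 q1) ->
  is_convergent v n.+1 p q -> p != lfloor v * q.
Proof.
move=> best vpq; apply/eqP => pE.
have v0 := convergent_nonpoly vpq; have [a a0 w_deg] := cf_tail_deg v0.
have tail_deg := has_degV w_deg; rewrite opprK -/(cf_tail v) in tail_deg.
have [/cf_reaches_tail[_ vn] q0 _ E] := vpq.
have /best[_ _] : is_convergent (cf_tail v) n 0 1.
  split=> //; rewrite ?oner_neq0 ?coprimep1// tofrac0 mul0r.
  move: E; rewrite -/(cf_truncation v n.+1) cf_truncation_tail.
  rewrite -/(cf_truncation (cf_tail v) n) pE tofracM mulfK ?tofrac_eq0//.
  by move/eqP; rewrite -subr_eq0 opprD addNKr oppr_eq0 invr_eq0 => /eqP.
rewrite rmorph1 mul1r raddf0 subr0 /pdeg size_poly1 oppr0 => tail_lt.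
by have := has_deg_lt tail_deg tail_lt; lia.
Qed.

Lemma convergent_best v n p q : is_convergent v n p q -> best_approx v p q.
Proof.
elim: n v p q => [|n IHn] v p q vpq; have [_ q0 pq _] := vpq; split=> //.
  have [pE dq] := convergent0 vpq.
  rewrite dq oppr0 pE [lfloor v * q]mulrC rmorphM /= -mulrBr.
  have := has_deg_ltM (has_deg_lpoly q0) (@deg_lt_fracpart _ v).
  by rewrite dq addr0.
have v0 := convergent_nonpoly vpq; have [a a0 w_deg] := cf_tail_deg v0.
have r0 := convergent_neq_floor (IHn (cf_tail v)) vpq.
have [_ _ e1_lt] := IHn _ _ _ (convergent_tail r0 vpq).
have e_lt : deg_lt (lpoly q * v - lpoly p) (- a - pdeg (p - lfloor v * q)).
  by rewrite cf_error//; apply: deg_ltN; rewrite mulrC; apply: has_deg_ltM.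
apply: deg_lt_le (e_lt); rewrite (cf_tail_partial_degree v0 w_deg r0 q0).
  by rewrite opprD.
by apply: deg_lt_le e_lt; rewrite /pdeg; lia.
Qed.

(** Both sides drop by the degree of the tail at each step of the expansion; at
    step [0] the error is a constant multiple of [v - a], whose degree is
    opposite to that of the first nontrivial denominator. *)
Lemma convergent_error_deg v n p q p' q' :
  is_convergent v n p q -> is_convergent v n.+1 p' q' ->
  has_deg (lpoly q * v - lpoly p) (- pdeg q').
Proof.
have tail_step v0 m p0 q0 a (r0 := p0 - lfloor v0 * q0) :
    is_convergent v0 m.+1 p0 q0 ->
    has_deg (v0 - lpoly (lfloor v0)) (- a) ->
    is_convergent (cf_tail v0) m q0 r0 /\ pdeg q0 = a + pdeg r0.
  move=> conv w_deg.
  have neq := convergent_neq_floor (@convergent_best _ m) conv.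
  have [q0_neq0 _ e_lt] := convergent_best conv.
  split; first exact: convergent_tail.
  apply: (cf_tail_partial_degree (convergent_nonpoly conv)) => //.
  by apply: deg_lt_le e_lt; rewrite /pdeg; lia.
elim: n v p q p' q' => [|n IHn] v p q p' q' vpq vpq'.
all: have v_np := convergent_nonpoly vpq'.
all: have [a a0 w_deg] := cf_tail_deg v_np.
all: have [tail' ->] := tail_step _ _ _ _ _ vpq' w_deg.
  have [_ ->] := convergent0 tail'; have [-> dq] := convergent0 vpq.
  rewrite [lfloor v * q]mulrC rmorphM /= -mulrBr addr0 -[- a]add0r -dq.
  by apply: has_degM => //; apply: has_deg_lpoly; have [] := vpq.
have [tail _] := tail_step _ _ _ _ _ vpq w_deg.
rewrite cf_error// opprD mulrC; apply: has_degN.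
by apply: has_degM => //; apply: IHn tail tail'.
Qed.

(** Legendre's criterion, by Euclid's algorithm: [q / r] is a best approximation
    of the tail, with a denominator of smaller degree. *)
Lemma best_convergent v p q :
  best_approx v p q -> exists n, is_convergent v n p q.
Proof.
move: {2}(size q) (leqnn (size q)) => s.
elim: s v p q => [|s IHs] v p q q_s [q0 pq e_lt].
  by move: q_s; rewrite leqn0 size_poly_eq0 (negbTE q0).
have e_lt0 : deg_lt (lpoly q * v - lpoly p) 0.
  by apply: deg_lt_le e_lt; rewrite /pdeg; lia.
have [pE|r0] := eqVneq p (lfloor v * q).
  exists 0; split=> //=; rewrite pE tofracM mulfK ?tofrac_eq0//.
have v0 : v != lpoly (lfloor v).
  apply: contraNneq r0 => vE; move: e_lt0.
  rewrite {1}vE mulrC -rmorphM -rmorphB.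
  by move=> /deg_lt_lpoly/eqP; rewrite subr_eq0 eq_sym.
have [a a0 w_deg] := cf_tail_deg v0.
have dq := cf_tail_partial_degree v0 w_deg r0 q0 e_lt0.
have r_neq0 : p - lfloor v * q != 0 by rewrite subr_eq0.
have [||n vn] := IHs (cf_tail v) q (p - lfloor v * q).
- move: dq r_neq0 q0 q_s; rewrite -!size_poly_gt0 /pdeg.
  by move: (size _) (size _); lia.
- split=> //; first by rewrite addrC -mulNr coprimep_addl_mul coprimep_sym.
  apply: (has_deg_ltMK w_deg); rewrite mulrC -[_ * _]opprK -cf_error//.
  by apply: deg_ltN; apply: deg_lt_le e_lt; rewrite dq; lia.
by exists n.+1; have := convergent_cons v0 q0 vn; rewrite addrC subrK.
Qed.

End Convergents.

(** * Substitution of a power of the variable *)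

Section Substitution.
Variables (F : fieldType) (d : nat).
Implicit Types (v w : laurent F) (p : {poly F}).

Lemma lsubst_bound v : exists N : int, forall k : int, N < k ->
  (if (d %| k)%Z then v (k %/ d)%Z else 0) = 0.
Proof.
have [N vN] := lcoef_bound v; exists (`|N|%N * d)%N => k k_gt.
case: ifP => // /dvdzP[j kE]; move: k_gt; rewrite kE.
case: (posnP d) => [->|d0]; first by rewrite mulr0 muln0 ltxx.
by rewrite mulzK; [move=> ?; apply: vN; nia|lia].
Qed.

Definition lsubst v : laurent F := Laurent (lsubst_bound v).

Lemma lcoef_lsubst v k :
  lsubst v k = if (d %| k)%Z then v (k %/ d)%Z else 0.
Proof. by []. Qed.

Lemma lsubst_is_zmod_morphism : zmod_morphism lsubst.
Proof.
move=> v w; apply: laurentP => k; rewrite lcoefD lcoefN !lcoef_lsubst.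
by case: ifP; rewrite ?lcoefD ?lcoefN ?subr0.
Qed.
HB.instance Definition _ := GRing.isZmodMorphism.Build (laurent F) (laurent F)
  lsubst lsubst_is_zmod_morphism.

Hypothesis d_gt0 : (0 < d)%N.
Let d_neq0 : d%:Z != 0. Proof. lia. Qed.

Lemma lsubst_monoM n v : lsubst (lmono F n * v) = lmono F (d%:Z * n) * lsubst v.
Proof.
apply: laurentP => k; rewrite lcoef_monoM !lcoef_lsubst lcoef_monoM.
rewrite [(d %| k)%Z](_ : _ = (d %| k - d%:Z * n)%Z); last first.
  by rewrite rpredBr// dvdz_mulr.
case: ifP => // /dvdzP[j kE]; rewrite kE mulzK//.
have -> : k = (j + n) * d%:Z by rewrite mulrDl -kE; ring.
by rewrite mulzK//; congr (v _); ring.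
Qed.

Lemma lsubst1 : lsubst 1 = 1.
Proof.
apply: laurentP => k; rewrite lcoef_lsubst !lcoef1.
have [->|k0] := eqVneq k 0; first by rewrite dvdz0 div0z.
case: ifP => // /dvdzP[j kE]; rewrite kE mulzK//; move: k0; rewrite kE.
by rewrite mulf_eq0 (negbTE d_neq0) orbF => /negbTE->.
Qed.

(** Horner's scheme reduces this to monomials and constants. *)
Lemma lsubst_polyM p v : lsubst (lpoly p * v) = lpoly (p \Po 'X^d) * lsubst v.
Proof.
elim/poly_ind: p => [|p c IHp].
  by rewrite comp_poly0 !raddf0 !mul0r raddf0.
rewrite comp_polyD comp_polyM comp_polyX comp_polyC !rmorphD !rmorphM /=.
rewrite !mulrDl raddfD /= -[_ * _ * v]mulrA mulrAC -IHp.
rewrite lpolyX [_ * (_ * v)]mulrCA; congr (_ + _); last first.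
  apply: laurentP => k; rewrite lcoef_lpolyC_M !lcoef_lsubst.
  by case: ifP; rewrite ?mulr0// lcoef_lpolyC_M.
rewrite lsubst_monoM mulrC; congr (_ * _).
by rewrite mulr1 rmorphXn /= lpolyX; elim: (d) => [|n IHn];
  rewrite ?expr0// exprS -IHn -lmonoD; congr lmono; lia.
Qed.

Lemma lsubst_poly p : lsubst (lpoly p) = lpoly (p \Po 'X^d).
Proof. by rewrite -[lpoly p]mulr1 lsubst_polyM lsubst1 mulr1. Qed.

(** Sharper than [d * n]: the exponents that occur are multiples of [d]. *)
Lemma deg_lt_lsubst v n : deg_lt v n -> deg_lt (lsubst v) (d%:Z * (n - 1) + 1).
Proof.
move=> vn k k_ge; rewrite lcoef_lsubst; case: ifP => // /dvdzP[j kE].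
by rewrite kE mulzK//; apply: vn; nia.
Qed.

Lemma has_deg_lsubst v n : has_deg v n -> has_deg (lsubst v) (d%:Z * n).
Proof.
move=> [vn v_lt]; split.
  by rewrite lcoef_lsubst dvdz_mulr// mulrC mulzK.
by apply: deg_lt_le (deg_lt_lsubst v_lt); rewrite addrK.
Qed.

Lemma pdeg_comp_Xn p : pdeg (p \Po 'X^d) = d%:Z * pdeg p.
Proof. by rewrite /pdeg size_comp_poly size_polyXn /= PoszM mulrC. Qed.

Lemma comp_Xn_neq0 p : p != 0 -> p \Po 'X^d != 0.
Proof.
rewrite -!lpoly_eq0 -lsubst_poly => p0.
by have [n /has_deg_lsubst/has_deg_neq0] := has_deg_exists p0.
Qed.

End Substitution.

(** * Alternation of the two kinds of convergents *)

Section Alternation.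
Variables (F : fieldType) (d : nat) (h : laurent F).
Hypothesis d_ge2 : (2 <= d)%N.
Let d_gt0 : (0 < d)%N := ltnW d_ge2.
Local Notation x1 := ('X - 1 : {poly F}).
Local Notation geo := (\sum_(i < d) 'X^i : {poly F}).

Let u := lpoly x1 * h.
Let g := lpoly x1 * lsubst d h.

(** The convergents of [g] of even index. The non-vanishing at [1] expresses
    that the factor [x - 1] of the numerator does not cancel. *)
Definition from_h (p q : {poly F}) := exists P Q,
  [/\ best_approx h P Q, Q.[1] != 0, p = x1 * (P \Po 'X^d) & q = Q \Po 'X^d].

(** The convergents of [g] of odd index; here [geo] does not cancel. *)
Definition from_u (p q : {poly F}) := exists P Q,
  [/\ best_approx u P Q, P.[1] != 0, p = P \Po 'X^d & q = geo * (Q \Po 'X^d)].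

Lemma has_deg_x1 : has_deg (lpoly x1) 1.
Proof.
have s2 : size x1 = 2 by rewrite -polyC1 size_XsubC.
have x10 : x1 != 0 by rewrite -size_poly_eq0 s2.
by have := has_deg_lpoly x10; rewrite /pdeg s2.
Qed.

Lemma x1_geo : x1 * geo = x1 \Po 'X^d.
Proof. by rewrite -subrX1 comp_polyB comp_polyX comp_polyC. Qed.

Lemma geo_neq0 : geo != 0.
Proof.
have : x1 * geo != 0.
  rewrite x1_geo comp_Xn_neq0// -lpoly_eq0; exact: has_deg_neq0 has_deg_x1.
by apply: contraNneq => ->; rewrite mulr0.
Qed.

Lemma pdeg_geo : pdeg geo = d%:Z - 1.
Proof.
have x10 : x1 != 0 by rewrite -lpoly_eq0; exact: has_deg_neq0 has_deg_x1.
have d1 := has_deg_uniq (has_deg_lpoly x10) has_deg_x1.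
by have := pdegM x10 geo_neq0; rewrite x1_geo pdeg_comp_Xn d1; lia.
Qed.

Lemma geo_g : lpoly geo * g = lsubst d u.
Proof. by rewrite /g mulrA -rmorphM [geo * _]mulrC x1_geo lsubst_polyM. Qed.

Lemma from_h_error P Q :
  lpoly (Q \Po 'X^d) * g - lpoly (x1 * (P \Po 'X^d)) =
  lpoly x1 * lsubst d (lpoly Q * h - lpoly P).
Proof.
rewrite (raddfB (lsubst d)) /= lsubst_polyM// lsubst_poly// /g.
by rewrite rmorphM /=; ring.
Qed.

Lemma from_u_error P Q :
  lpoly (geo * (Q \Po 'X^d)) * g - lpoly (P \Po 'X^d) =
  lsubst d (lpoly Q * u - lpoly P).
Proof.
rewrite (raddfB (lsubst d)) /= lsubst_polyM// lsubst_poly// -geo_g rmorphM /=.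
by rewrite -mulrA mulrCA.
Qed.

(** Subtracting a constant multiple of [(P, Q)] from the next approximation
    leaves the determinant and the degree of the denominator unchanged, and
    costs one unit in the error. The constant [k] will be chosen to create a
    root at [1]; dividing out [x - 1] recovers that unit. *)
Lemma combine_next (v : laurent F) P Q P' Q' (k : F) b :
  best_approx v P Q -> has_deg (lpoly Q * v - lpoly P) (- b) ->
  P' * Q - P * Q' = 1 -> Q' != 0 -> pdeg Q' = b ->
  deg_lt (lpoly Q' * v - lpoly P') (- b) ->
  [/\ (P' - k *: P) * Q - P * (Q' - k *: Q) = 1, Q' - k *: Q != 0,
      pdeg (Q' - k *: Q) = b &
      deg_lt (lpoly (Q' - k *: Q) * v - lpoly (P' - k *: P)) (- b + 1)].
Proof.
move=> [Q0 PQ e_lt] e_deg det1 Q'0 dQ' e'_lt.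
have Q1_deg : has_deg (lpoly (Q' - k *: Q)) b.
  rewrite raddfB /=; apply: has_degD.
    by rewrite -dQ'; apply: has_deg_lpoly.
  apply: deg_ltN => j j_ge; rewrite lcoef_lpolyZ.
  have [_ Q_lt] := has_deg_lpoly Q0; rewrite Q_lt ?mulr0//.
  by have := has_deg_lt e_deg e_lt; lia.
have Q10 : Q' - k *: Q != 0 by rewrite -lpoly_eq0 (has_deg_neq0 Q1_deg).
split=> //.
- by rewrite -det1 -!mul_polyC; ring.
- exact: has_deg_uniq (has_deg_lpoly Q10) Q1_deg.
have -> : lpoly (Q' - k *: Q) * v - lpoly (P' - k *: P) =
    lpoly Q' * v - lpoly P' - lpoly k%:P * (lpoly Q * v - lpoly P).
  by rewrite -!mul_polyC !rmorphB !rmorphM /=; ring.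
apply: deg_ltB; first by apply: deg_lt_le e'_lt; lia.
move=> j j_ge; rewrite lcoef_lpolyC_M; have [_ ->] := e_deg; rewrite ?mulr0//.
Qed.

(** The denominator created with a root at [1] is [x1 * Q2], and [Q2] is the
    denominator for [u = x1 * h]; the degrees add up to
    [(d - 1) + d (b - 1) = d b - 1], the degree required of [q']. *)
Lemma from_h_next p q p' q' : from_h p q -> best_approx g p' q' ->
  has_deg (lpoly q * g - lpoly p) (- pdeg q') -> from_u p' q'.
Proof.
move=> [P [Q [hPQ Q1 -> ->]]] gp'q'; rewrite from_h_error => err_deg.
set e := lpoly Q * h - lpoly P in err_deg.
have e0 : e != 0.
  by apply: contraNneq (has_deg_neq0 err_deg) => ->; rewrite raddf0 mulr0.
have [b' e_deg'] := has_deg_exists e0; pose b := - b'.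
have e_deg : has_deg e (- b) by rewrite opprK.
have dq' : pdeg q' = d%:Z * b - 1.
  have := has_degM has_deg_x1 (has_deg_lsubst d_gt0 e_deg).
  by move=> /(has_deg_uniq err_deg); lia.
have [P' [Q' [det1 Q'0 dQ' e'_lt]]] := next_best_approx hPQ e_deg.
pose k := Q'.[1] / Q.[1].
have rootR : root (Q' - k *: Q) 1.
  by rewrite /root hornerD hornerN hornerZ divfK// subrr.
have [] := combine_next k hPQ e_deg det1 Q'0 dQ' e'_lt.
move: rootR; move: (P' - _) (Q' - _) => P1 R.
move=> /factor_theorem[Q2]; rewrite polyC1 mulrC => RE det2 R0 dR e1_lt.
have Q20 : Q2 != 0 by apply: contraNneq R0; rewrite RE => ->; rewrite mulr0.
have dQ2 : pdeg Q2 = b - 1.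
  have := has_degM has_deg_x1 (has_deg_lpoly Q20); rewrite -rmorphM /= -RE.
  by move=> /(has_deg_uniq (has_deg_lpoly R0)); lia.
have uE : lpoly Q2 * u - lpoly P1 = lpoly R * h - lpoly P1.
  by rewrite RE /u rmorphM /=; ring.
have P11 : P1.[1] != 0.
  have /(congr1 (horner^~ 1)) := det2.
  rewrite RE !hornerE subrr /= mulr0 mul0r subr0.
  by move/eqP; apply: contraTneq => ->; rewrite mul0r eq_sym oner_eq0.
have uP1Q2 : best_approx u P1 Q2.
  split=> //; last by rewrite uE dQ2; apply: deg_lt_le e1_lt; lia.
  apply/Bezout_eq1_coprimepP; exists (Q, - (P * x1)) => /=.
  by rewrite -[RHS]det2 RE; ring.
have q2_neq0 : geo * (Q2 \Po 'X^d) != 0.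
  by rewrite mulf_neq0 ?geo_neq0// comp_Xn_neq0.
have q2_deg : pdeg (geo * (Q2 \Po 'X^d)) = pdeg q'.
  by rewrite pdegM ?geo_neq0 ?comp_Xn_neq0// pdeg_geo pdeg_comp_Xn dQ2 dq'; lia.
have [|c c0 [pE qE]] :=
    best_approx_uniq (p1 := P1 \Po 'X^d) gp'q' q2_neq0 q2_deg.
  rewrite from_u_error uE q2_deg dq'.
  by apply: deg_lt_le (deg_lt_lsubst d_gt0 e1_lt); lia.
exists (c^-1 *: P1), (c^-1 *: Q2); split.
- by apply: best_approxZ uP1Q2; rewrite invr_eq0.
- by rewrite hornerZ mulf_neq0// invr_eq0.
- by rewrite comp_polyZ pE scalerA mulVf// scale1r.
- by rewrite comp_polyZ -scalerAr qE scalerA mulVf// scale1r.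
Qed.

(** Now the numerator is given a root at [1]; dividing it by [x1] passes from
    [u] to [h] and improves the error by one unit, and the degree of the
    denominator is [d b] as required. *)
Lemma from_u_next p q p' q' : from_u p q -> best_approx g p' q' ->
  has_deg (lpoly q * g - lpoly p) (- pdeg q') -> from_h p' q'.
Proof.
move=> [P [Q [uPQ P1 -> ->]]] gp'q'; rewrite from_u_error => err_deg.
set e := lpoly Q * u - lpoly P in err_deg.
have e0 : e != 0.
  by apply: contraNneq (has_deg_neq0 err_deg) => ->; rewrite raddf0.
have [b' e_deg'] := has_deg_exists e0; pose b := - b'.
have e_deg : has_deg e (- b) by rewrite opprK.
have dq' : pdeg q' = d%:Z * b.
  by have := has_deg_uniq err_deg (has_deg_lsubst d_gt0 e_deg); lia.
have [P' [Q' [det1 Q'0 dQ' e'_lt]]] := next_best_approx uPQ e_deg.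
pose k := P'.[1] / P.[1].
have rootR : root (P' - k *: P) 1.
  by rewrite /root hornerD hornerN hornerZ divfK// subrr.
have [] := combine_next k uPQ e_deg det1 Q'0 dQ' e'_lt.
move: rootR; move: (P' - _) (Q' - _) => R Q1.
move=> /factor_theorem[P2]; rewrite polyC1 mulrC => RE det2 Q10 dQ1 e1_lt.
have uE : lpoly Q1 * u - lpoly R = lpoly x1 * (lpoly Q1 * h - lpoly P2).
  by rewrite RE /u rmorphM /=; ring.
have e2_lt : deg_lt (lpoly Q1 * h - lpoly P2) (- b).
  by apply: (has_deg_ltMK has_deg_x1); rewrite -uE; apply: deg_lt_le e1_lt; lia.
have Q11 : Q1.[1] != 0.
  have /(congr1 (horner^~ 1)) := det2.
  rewrite RE !hornerE subrr /= ?mul0r ?sub0r.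
  by move/eqP; apply: contraTneq => ->; rewrite mulr0 oppr0 eq_sym oner_eq0.
have hP2Q1 : best_approx h P2 Q1.
  split=> //; last by rewrite dQ1.
  apply/Bezout_eq1_coprimepP; exists (x1 * Q, - P) => /=.
  by rewrite -[RHS]det2 RE; ring.
have q1_neq0 : Q1 \Po 'X^d != 0 by rewrite comp_Xn_neq0.
have q1_deg : pdeg (Q1 \Po 'X^d) = pdeg q' by rewrite pdeg_comp_Xn dQ1 dq'.
have [|c c0 [pE qE]] :=
    best_approx_uniq (p1 := x1 * (P2 \Po 'X^d)) gp'q' q1_neq0 q1_deg.
  rewrite from_h_error q1_deg dq'.
  have := has_deg_ltM has_deg_x1 (deg_lt_lsubst d_gt0 e2_lt).
  by apply: deg_lt_le; lia.
exists (c^-1 *: P2), (c^-1 *: Q1); split.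
- by apply: best_approxZ hP2Q1; rewrite invr_eq0.
- by rewrite hornerZ mulf_neq0// invr_eq0.
- by rewrite comp_polyZ -scalerAr pE scalerA mulVf// scale1r.
- by rewrite comp_polyZ qE scalerA mulVf// scale1r.
Qed.

Lemma convergent_alternation m p q : deg_lt h 0 -> deg_lt g 0 ->
  is_convergent g m p q -> if odd m then from_u p q else from_h p q.
Proof.
move=> h_lt g_lt; elim: m p q => [|m IHm] p q gpq.
  have [pE dq] := convergent0 gpq; have [q0 pq _] := convergent_best gpq.
  have p0 : p = 0.
    by rewrite pE (@lfloor_uniq _ g 0) ?mul0r// raddf0 subr0.
  have [c qE] : exists c, q = c%:P.
    by exists q`_0; apply: size1_polyC; move: dq; rewrite /pdeg; lia.
  rewrite /=; exists 0, q; split.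
  - split; rewrite ?q0 -?p0//; rewrite p0 raddf0 subr0 dq.
    by have := has_deg_ltM (has_deg_lpoly q0) h_lt; rewrite dq.
  - by move: q0; rewrite qE hornerC polyC_eq0.
  - by rewrite comp_poly0 mulr0.
  - by rewrite qE comp_polyC.
have [reach _ _ _] := gpq.
have [p0 [q0 g0]] : exists p0 q0, is_convergent g m p0 q0.
  by apply: convergent_of_reaches => i i_m; apply: reach; apply: ltnW.
have err := convergent_error_deg g0 gpq; have best := convergent_best gpq.
have := IHm _ _ g0 => /=; case: (odd m) => /= prev.
  exact: from_u_next prev best err.
exact: from_h_next prev best err.
Qed.

End Alternation.

(** * The functional equations *)

Section MahlerFunction.
Variable d : nat.
Hypothesis d_ge2 : (2 <= d)%N.
Let d_gt0 : (0 < d)%N := ltnW d_ge2.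

Let factor (t : nat) : laurent rat := 1 - lmono rat (- (d ^ t)%N%:Z).
Let partial (n : nat) : laurent rat := \prod_(t < n) factor t.

Lemma partialS n : partial n.+1 = partial n * factor n.
Proof. by rewrite /partial big_ord_recr. Qed.

Lemma lsubst_partial n : partial n.+1 = factor 0 * lsubst d (partial n).
Proof.
elim: n => [|n IHn].
  by rewrite /partial big_ord1 big_ord0 lsubst1// mulr1.
have subst_factor v : lsubst d (factor n * v) = factor n.+1 * lsubst d v.
  rewrite /factor !mulrBl !mul1r raddfB /= lsubst_monoM//.
  by rewrite expnS PoszM mulrN.
rewrite partialS [in LHS]IHn [in RHS]partialS [partial n * _]mulrC subst_factor.
by rewrite -mulrA [lsubst d _ * _]mulrC.
Qed.

Lemma f_coef_partial k : exists n0 : nat, forall n : nat, (n0 <= n)%N ->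
  f_ d k = partial n k.
Proof.
have [n0 f_n0] := f_cvg d_ge2 k; exists n0 => n n_ge.
by rewrite -(f_n0 n k).
Qed.

(** Each coefficient of either side involves finitely many coefficients of
    [f_ d], all of which are those of a long enough partial product. *)
Lemma f_functional_equation : f_ d = (1 - lmono rat (- 1)) * lsubst d (f_ d).
Proof.
apply: laurentP => k.
have [n1 f1] := f_coef_partial k.
have [n2 f2] := f_coef_partial (k %/ d)%Z.
have [n3 f3] := f_coef_partial ((k + 1) %/ d)%Z.
pose n := maxn n1 (maxn n2 n3).
rewrite (f1 n.+1) ?lsubst_partial; last by rewrite /n; lia.
rewrite /factor expn0 !mulrBl !mul1r !lcoefD !lcoefN !lcoef_monoM opprK.
by rewrite !lcoef_lsubst (f2 n) ?(f3 n)//; rewrite /n; lia.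
Qed.

Lemma f_deg_lt : deg_lt (f_ d) 1.
Proof.
have partial_lt n : deg_lt (partial n) 1.
  elim: n => [|n IHn]; first by rewrite /partial big_ord0; case: (has_deg1 rat).
  rewrite partialS; apply: (@deg_lt_le _ _ (1 + 1 - 1)) => //.
  apply: deg_ltM => //.
  apply: deg_ltB; first by case: (has_deg1 rat).
  by have := @deg_lt_lmono rat (- (d ^ n)%N%:Z); apply: deg_lt_le; lia.
move=> k k_ge; have [n f_n] := f_coef_partial k.
by rewrite (f_n n)// partial_lt.
Qed.

Lemma lpoly_x1 : lpoly ('X - 1 : {poly rat}) = lmono rat 1 - 1.
Proof. by rewrite rmorphB rmorph1 /= lpolyX. Qed.

Lemma u_h : u_ d = lpoly ('X - 1) * h_ d.
Proof.
have E : (lmono rat 1 - 1) * lmono rat (- 1) = 1 - lmono rat (- 1).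
  by rewrite mulrBl -lmonoD mul1r.
by rewrite /u_ /h_ lpoly_x1 mulrA E.
Qed.

Lemma g_h : g_ d = lpoly ('X - 1) * lsubst d (h_ d).
Proof.
have E : (lmono rat 1 - 1) * lmono rat (- d%:Z) =
    lmono rat (- d%:Z + 1) * (1 - lmono rat (- 1)).
  by rewrite mulrBl mulrBr mul1r mulr1 -!lmonoD addrK [1 + _]addrC.
rewrite /g_ /h_ lpoly_x1 lsubst_monoM// mulrN1 {1}f_functional_equation.
by rewrite !mulrA E.
Qed.

Lemma h_deg_lt : deg_lt (h_ d) 0.
Proof. exact: has_deg_ltM (has_deg_lmono _ _) f_deg_lt. Qed.

Lemma g_deg_lt : deg_lt (g_ d) 0.
Proof.
by apply: deg_lt_le (has_deg_ltM (has_deg_lmono _ _) f_deg_lt); lia.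
Qed.

End MahlerFunction.

Theorem theorem1 (d m : nat) (hd : (2 <= d)%N) (p q : {poly rat})
  (hpq : is_convergent (g_ d) m p q) :
  (odd m ->
     exists (t : nat) (P Q : {poly rat}),
       [/\ is_convergent (u_ d) t P Q,
           tofrac p / tofrac q =
             tofrac (P \Po 'X^d)
               / tofrac ((\sum_(i < d) 'X^i) * (Q \Po 'X^d))
             :> {fraction {poly rat}}
         & ~~ (('X - 1) %| P)]) /\
  (~~ odd m ->
     exists (t : nat) (P Q : {poly rat}),
       [/\ is_convergent (h_ d) t P Q,
           tofrac p / tofrac q =
             tofrac (('X - 1) * (P \Po 'X^d)) / tofrac (Q \Po 'X^d)
             :> {fraction {poly rat}}
         & ~~ (('X - 1) %| Q)]).
Proof.
have dvd_x1 (R : {poly rat}) : (('X - 1) %| R) = (R.[1] == 0).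
  by rewrite -polyC1 dvdp_XsubCl.
move: hpq; rewrite g_h// => hpq.
have g_lt := g_deg_lt hd; rewrite g_h// in g_lt.
have := convergent_alternation hd (h_deg_lt hd) g_lt hpq.
case: (odd m) => -[P [Q [best R1 -> ->]]]; split=> // _.
  have [t conv] := best_convergent best.
  by exists t, P, Q; split; rewrite ?u_h// dvd_x1.
have [t conv] := best_convergent best.
by exists t, P, Q; split; rewrite // dvd_x1.
Qed.
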